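(* Let $T\rtimes R$ be a semidirect product of finite $2$-groups with $T$ normal and $R$ abelian, write $TR=T\rtimes R$, let $n\ge1$, and let $S(T,R,J)$ be the associated group of $n\times n$ monomial matrices over $TR$ (defined in the context). Let $E_0$ and $R_0$ be elementary abelian subgroups of $T$ and $R$ respectively such that $\langle E_0,R_0\rangle=E_0\times R_0$ is elementary abelian. Let $E$ be an elementary abelian subgroup of $S(T,R,J)$ of dimension $r_2(S(T,R,J))$. Then $r_2(E)\ge n\cdot r_2(E_0)+(n-1)\,r_2(R_0)$.
   Context: For a finite $2$-group $P$, $r_2(P)$ is the maximal dimension over $\mathbb Z_2$ of an elementary abelian subgroup of $P$. Matrices below are monomial matrices with nonzero entries in the group $TR$, multiplied in the usual way. For $r\in R$ let $d_k(r)$ be the $2^k\times2^k$ diagonal matrix $\mathrm{diag}(r,1,\dots,1)$, and $d_0(r)=(r)$. Define $w_0(T,R,J)=T$ and, inductively, let $w_{k+1}(T,R,J)$ be the group of $2^{k+1}\times2^{k+1}$ matrices generated by all $\mathrm{diag}(a,I_{2^k})$ and $\mathrm{diag}(I_{2^k},a)$ with $a\in w_k(T,R,J)$, all $\mathrm{diag}(d_k(r),d_k(r)^{-1})$ with $r\in R$, and the permutation matrix $\begin{pmatrix}0&I_{2^k}\\ I_{2^k}&0\end{pmatrix}$. Let $n=2^{m_1}+2^{m_2}+\cdots+2^{m_u}$, $m_1<m_2<\cdots<m_u$, be the $2$-adic representation of $n$. Let $W(T,R,J)$ be the group of $n\times n$ block diagonal matrices $\mathrm{diag}(a_1,\dots,a_u)$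 with $a_i\in w_{m_i}(T,R,J)$. Let $U(R)=1$ if $u=1$; if $u\ge2$, let $U(R)$ be the group generated by the block diagonal matrices, for $r\in R$ and $1\le i\le u-1$, whose $i$-th and $(i+1)$-th blocks are $d_{m_i}(r)$ and $d_{m_{i+1}}(r)$ and whose $j$-th block is $I_{2^{m_j}}$ for $j\ne i,i+1$. Then $U(R)$ normalises $W(T,R,J)$ and $S(T,R,J)=W(T,R,J)\rtimes U(R)$. *)

(* Defs.v *)
From HB Require Import structures.
From mathcomp Require Import all_boot all_fingroup all_algebra all_solvable.

Set Implicit Arguments.
Unset Strict Implicit.
Unset Printing Implicit Defensive.

Import GroupScope.

(* Monomial matrices over a finite group gT. A matrix entry lives in          *)
(* option gT, where None stands for 0 and Some x for the group element x.     *)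

Section GroupWithZero.
Variable gT : finGroupType.
Implicit Types x y z : option gT.

Definition mul0 x y : option gT :=
  if x is Some a then if y is Some b then Some (a * b) else None else None.

(* Only sums with at most one nonzero summand occur in a product of monomial  *)
(* matrices; the value for two nonzero summands is irrelevant.                *)
Definition add0 x y : option gT := if x is Some _ then x else y.

Lemma add0A : associative add0. Proof. by case. Qed.
Lemma add00x : left_id None add0. Proof. by []. Qed.
Lemma add0x0 : right_id None add0. Proof. by case. Qed.

HB.instance Definition _ := Monoid.isLaw.Build (option gT) None add0
  add0A add00x add0x0.

End GroupWithZero.

Definition mulmx0 (gT : finGroupType) m n p
    (A : 'M[option gT]_(m, n)) (B : 'M[option gT]_(n, p)) : 'M[option gT]_(m, p) :=
  \matrix_(i, k) \big[@add0 gT/None]_j mul0 (A i j) (B j k).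

Definition monomial (gT : finGroupType) n (A : 'M[option gT]_n) : bool :=
  [forall i, #|[pred j | A i j]| == 1%N] && [forall j, #|[pred i | A i j]| == 1%N].

Record mon (gT : finGroupType) n : predArgType :=
  Mon { mon_mx :> 'M[option gT]_n; mon_monomial : monomial mon_mx }.

HB.instance Definition _ (gT : finGroupType) n := [isSub for @mon_mx gT n].
HB.instance Definition _ (gT : finGroupType) n := [Finite of mon gT n by <:].

(* The matrix whose row i has its only nonzero entry f i in column s i.       *)
Definition permdiag (gT : finGroupType) n (s : 'S_n) (f : 'I_n -> gT) :
    'M[option gT]_n :=
  \matrix_(i, j) (if j == s i then Some (f i) else None).

(* Inverse of a monomial matrix: transpose and invert the nonzero entries.    *)
Definition invmx0 (gT : finGroupType) n (A : 'M[option gT]_n) : 'M[option gT]_n :=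
  map_mx (omap invg) A^T%R.

Section MonomialGroup.
Variables (gT : finGroupType) (n : nat).
Implicit Types (s t : 'S_n) (f g : 'I_n -> gT) (A B C : mon gT n).

Lemma eq_permdiag s f g : f =1 g -> permdiag s f = permdiag s g.
Proof. by move=> fg; apply/matrixP=> i j; rewrite !mxE fg. Qed.

Lemma permdiag_monomial s f : monomial (permdiag s f).
Proof.
apply/andP; split; apply/forallP=> i; apply/eqP.
  rewrite -(card1 (s i)); apply: eq_card => j.
  by rewrite !inE mxE; case: eqP.
rewrite -(card1 (s^-1 i)); apply: eq_card => j.
by rewrite !inE mxE -(inj_eq (@perm_inj _ s) j) permKV eq_sym; case: eqP.
Qed.

Lemma monomialP (M : 'M[option gT]_n) :
  reflect (exists s f, M = permdiag s f) (monomial M).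
Proof.
apply: (iffP idP) => [|[s [f ->]]]; last exact: permdiag_monomial.
case/andP=> /forallP rowM /forallP colM.
pose s0 i := sval (mem_card1 (eqP (rowM i))).
have s0P i j : M i j = (j == s0 i) :> bool.
  by have := svalP (mem_card1 (eqP (rowM i))) j; rewrite !inE.
have s0I : injective s0.
  move=> i i' eq_s; have [k Dk] := mem_card1 (eqP (colM (s0 i))).
  have := Dk i; have := Dk i'; rewrite !inE !s0P eq_s !eqxx.
  by move=> /esym/eqP-> /esym/eqP->.
exists (perm s0I), (fun i => odflt 1 (M i (s0 i))).
apply/matrixP=> i j; rewrite !mxE permE; have := s0P i j.
by case: eqP => [->|_]; case: (M i _).
Qed.

Lemma mulmx_permdiag s t f g :
  mulmx0 (permdiag s f) (permdiag t g)
    = permdiag (s * t) (fun i => f i * g (s i)).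
Proof.
apply/matrixP=> i k; rewrite !mxE.
rewrite (eq_bigr (fun j => if j == s i then
  (if k == t (s i) then Some (f i * g (s i)) else None) else None)).
  by rewrite -big_mkcond big_pred1_eq permM.
by move=> j _; rewrite !mxE; case: (j =P s i) => [->|//]; case: eqP.
Qed.

Lemma invmx_permdiag s f :
  invmx0 (permdiag s f) = permdiag s^-1 (fun i => (f (s^-1 i))^-1).
Proof.
apply/matrixP=> i j; rewrite !mxE -(inj_eq (@perm_inj _ s) j) permKV eq_sym.
by case: eqP => // <-; rewrite permK.
Qed.

Definition mulmon A B : mon gT n.
Proof.
refine (@Mon gT n (mulmx0 A B) _); apply/monomialP.
have /monomialP[s [f ->]] := mon_monomial A.
have /monomialP[t [g ->]] := mon_monomial B.
by rewrite mulmx_permdiag; do 2 eexists.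
Defined.

Definition invmon A : mon gT n.
Proof.
refine (@Mon gT n (invmx0 A) _); apply/monomialP.
have /monomialP[s [f ->]] := mon_monomial A.
by rewrite invmx_permdiag; do 2 eexists.
Defined.

(* diag(f 0, ..., f (n - 1)) *)
Definition diagmon f : mon gT n := Mon (permdiag_monomial 1 f).

Lemma mulmonA : associative mulmon.
Proof.
move=> A B C; apply: val_inj => /=.
have /monomialP[s [f ->]] := mon_monomial A.
have /monomialP[t [g ->]] := mon_monomial B.
have /monomialP[u [h ->]] := mon_monomial C.
rewrite !mulmx_permdiag mulgA; apply: eq_permdiag => i.
by rewrite permM mulgA.
Qed.

Lemma mul1mon : left_id (diagmon (fun=> 1)) mulmon.
Proof.
move=> A; apply: val_inj => /=.
have /monomialP[s [f ->]] := mon_monomial A.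
rewrite mulmx_permdiag mul1g; apply: eq_permdiag => i.
by rewrite perm1 mul1g.
Qed.

Lemma mulVmon : left_inverse (diagmon (fun=> 1)) invmon mulmon.
Proof.
move=> A; apply: val_inj => /=.
have /monomialP[s [f ->]] := mon_monomial A.
rewrite invmx_permdiag mulmx_permdiag mulVg; apply: eq_permdiag => i.
by rewrite mulVg.
Qed.

HB.instance Definition _ :=
  Finite_isGroup.Build (mon gT n) mulmonA mul1mon mulVmon.

End MonomialGroup.

Section Blocks.
Variables (gT : finGroupType).

Let zero m n : 'M[option gT]_(m, n) := const_mx None.
Let one n : mon gT n := 1%g.

Lemma monomial_tr n (A : 'M[option gT]_n) : monomial A^T%R = monomial A.
Proof.
rewrite /monomial andbC; congr (_ && _); apply: eq_forallb => i; congr (_ == _);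
  by apply: eq_card => j; rewrite !inE mxE.
Qed.

Lemma row_monomial n (A : 'M[option gT]_n) i : monomial A ->
  exists j, forall k, A i k = (k == j) :> bool.
Proof.
by case/andP=> /forallP/(_ i)/card1P[j Dj] _; exists j => k; have := Dj k; rewrite !inE.
Qed.

Lemma bdiag_monomial m n (A : mon gT m) (B : mon gT n) :
  monomial (block_mx A (zero _ _) (zero _ _) B).
Proof.
wlog suff: m n A B / forall i, #|[pred j | block_mx A (zero _ _) (zero _ _) B i j]| == 1%N.
  move=> IH; apply/andP; split; apply/forallP=> i; first exact: IH.
  pose trm p (C : mon gT p) := Mon (etrans (monomial_tr C) (mon_monomial C)).
  have /eqP<- := IH _ _ (trm _ A) (trm _ B) i; apply/eqP/eq_card => j.
  have -> : block_mx A^T%R (zero m n) (zero n m) B^T%R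
            = (block_mx A (zero m n) (zero n m) B)^T%R.
    by rewrite tr_block_mx !trmx_const.
  by rewrite !inE [(_^T)%R _ _]mxE.
move=> i; apply/card1P; case: (split_ordP i) => {}i ->.
  have [j Dj] := row_monomial i (mon_monomial A); exists (lshift n j) => k.
  rewrite !inE; case: (split_ordP k) => {}k ->.
    by rewrite block_mxEul Dj (inj_eq (@lshift_inj _ _)).
  by rewrite block_mxEur mxE eq_rlshift.
have [j Dj] := row_monomial i (mon_monomial B); exists (rshift m j) => k.
rewrite !inE; case: (split_ordP k) => {}k ->.
  by rewrite block_mxEdl mxE eq_lrshift.
by rewrite block_mxEdr Dj (inj_eq (@rshift_inj _ _)).
Qed.

Lemma bswap_monomial n :
  monomial (block_mx (zero _ _) (one n) (one n) (zero _ _)).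
Proof.
pose M := block_mx (zero n n) (one n) (one n) (zero n n).
have rowM i : #|[pred j | M i j]| == 1%N.
  apply/card1P; case: (split_ordP i) => {}i ->.
    exists (rshift n i) => k; rewrite !inE; case: (split_ordP k) => {}k ->.
      by rewrite block_mxEul mxE eq_lrshift.
    by rewrite block_mxEur mxE perm1 (inj_eq (@rshift_inj _ _)); case: eqP.
  exists (lshift n i) => k; rewrite !inE; case: (split_ordP k) => {}k ->.
    by rewrite block_mxEdl mxE perm1 (inj_eq (@lshift_inj _ _)); case: eqP.
  by rewrite block_mxEdr mxE eq_rlshift.
apply/andP; split; apply/forallP=> // j; have /eqP<- := rowM j.
have trM : M^T%R = M.
  have tr1 : (mon_mx (one n))^T%R = one n.
    by apply/matrixP=> a b; rewrite !mxE !perm1 eq_sym; case: eqP => // ->.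
  by rewrite /M tr_block_mx !trmx_const tr1.
by apply/eqP/eq_card => i; rewrite !inE -{1}trM [(_^T)%R _ _]mxE.
Qed.

End Blocks.

(* diag(A, B) *)
Definition bdiag (gT : finGroupType) m n (A : mon gT m) (B : mon gT n) :
  mon gT (m + n) := Mon (bdiag_monomial A B).

(* The permutation matrix ((0, I_n), (I_n, 0)) *)
Definition bswap (gT : finGroupType) n : mon gT (n + n) :=
  Mon (bswap_monomial gT n).

(* 2 ^ k, in a form for which the 2 x 2 block structure of w_{k+1} needs no   *)
(* cast.                                                                      *)
Fixpoint dim k : nat := if k is k'.+1 then (dim k' + dim k')%N else 1%N.

Lemma dimE k : dim k = (2 ^ k)%N.
Proof. by elim: k => //= k ->; rewrite addnn -mul2n expnS. Qed.

(* dims [:: m_1; ...; m_u] = 2 ^ m_1 + ... + 2 ^ m_u *)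
Fixpoint dims (m : seq nat) : nat :=
  if m is k :: m' then (dim k + dims m')%N else 0%N.

Lemma dimsE m : dims m = (\sum_(k <- m) 2 ^ k)%N.
Proof.
by elim: m => [|k m IHm] /=; rewrite ?big_nil // big_cons IHm dimE.
Qed.

Section Groups.
Variable gT : finGroupType.
Implicit Types (T R : {set gT}) (r : gT) (m : seq nat).

(* d_k(r) = diag(r, 1, ..., 1) *)
Definition dmon k r : mon gT (dim k) :=
  diagmon (fun i => if i == 0%N :> nat then r else 1).

(* w_0(T, R, J) = T, as 1 x 1 matrices. *)
Fixpoint wmon T R k : {set mon gT (dim k)} :=
  if k is k'.+1 then
    << [set bdiag a 1 | a in wmon T R k'] :|: [set bdiag 1 a | a in wmon T R k']
       :|: [set bdiag (dmon k' r) (dmon k' r)^-1 | r in R] :|: [set bswap gT _] >>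
  else [set dmon 0 t | t in T].

(* { diag(a_1, ..., a_u) : a_i in w_{m_i}(T, R, J) } for m = [:: m_1; ...; m_u] *)
Fixpoint Wmon T R m : {set mon gT (dims m)} :=
  if m is k :: m' then
    [set bdiag x.1 x.2 | x in setX (wmon T R k) (Wmon T R m')]
  else 1.

(* The block diagonal matrix whose j-th block, counted from 0, is d_{m_j}(r)  *)
(* if P j holds, and the identity otherwise.                                  *)
Fixpoint dblocks r (P : pred nat) m : mon gT (dims m) :=
  if m is k :: m' then
    bdiag (if P 0%N then dmon k r else 1) (dblocks r (fun j => P j.+1) m')
  else 1.

Definition Umon R m : {group mon gT (dims m)} :=
  << \bigcup_(i < (size m).-1)
       [set dblocks r (fun j => (j == i :> nat) || (j == i.+1)) m | r in R] >>%G.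

(* Umon normalises Wmon and meets it trivially (project the product of the    *)
(* entries of each block to R), so the join is the semidirect product.        *)
Definition Smon T R m : {group mon gT (dims m)} := (Wmon T R m <*> Umon R m)%G.

End Groups.

(* Main.v *)
From mathcomp Require Import all_boot all_fingroup all_algebra all_solvable.
Require Import Defs.

Set Implicit Arguments.
Unset Strict Implicit.
Unset Printing Implicit Defensive.

Import GroupScope.

(** Since [E] has the maximal rank, it is enough to find one elementary abelian
subgroup of [S = Smon T R m] of rank at least [n e + (n - 1) c], where [e] and
[c] are the ranks of [E0] and [R0].  Put [A = E0 x R0] and let [Delta] be the
group of all diagonal matrices with entries in [A]: it is elementary abelian of
rank [n (e + c)], and the subgroup that is used is [Delta :&: S].

The intersection loses at most [c] dimensions.  Write [delta j x] for the
diagonal matrix with [x] in position [j] and [1] elsewhere, and let [Z] consist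
of the [delta 0 r] with [r] in [R0].  Then [Delta = (Delta :&: S) * Z], because [Delta] is
generated by the [delta j (a * r)] with [a] in [E0] and [r] in [R0], and
  [delta j (a * r) = delta j a * (delta j r * (delta 0 r)^-1) * delta 0 r]
where the first two factors lie in [S]:
- [delta j a] lies in [S] for all [a] in [T] ([delta_Smon]);
- [delta j r * (delta 0 r)^-1] lies in [S] for every [r] in [R] with [r ^+ 2 = 1]
  ([delta_ratio_Smon]).  Inside a block this holds for every [r] in [R], by
  composing the generators [diag(d_k(r), d_k(r)^-1)]; to pass from a block to
  the next one the generators of [U(R)] are used, which carry [r] twice instead
  of [r] and [r^-1], whence the condition [r = r^-1]. *)

(** * Diagonal matrices *)

Section Diagonal.
Variable gT : finGroupType.
Implicit Types (x y r t : gT) (A T R : {group gT}).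

Lemma eq_diagmon n (f g : 'I_n -> gT) : f =1 g -> diagmon f = diagmon g.
Proof. by move=> fg; apply: val_inj; apply: eq_permdiag. Qed.

Lemma diagmonM n (f g : 'I_n -> gT) :
  diagmon f * diagmon g = diagmon (fun i => f i * g i).
Proof.
apply: val_inj; rewrite /= mulmx_permdiag mulg1.
by apply: eq_permdiag => i; rewrite perm1.
Qed.

Lemma diagmon1 n : diagmon (fun=> 1) = 1 :> mon gT n.
Proof. by []. Qed.

Lemma diagmon_inj n (f g : 'I_n -> gT) : diagmon f = diagmon g -> f =1 g.
Proof.
move=> fg i; have /matrixP/(_ i i) := congr1 val fg.
by rewrite !mxE perm1 eqxx => -[].
Qed.

Lemma diagmon_prod n I (s : seq I) (F : I -> 'I_n -> gT) :
  \prod_(i <- s) diagmon (F i) = diagmon (fun j => \prod_(i <- s) F i j).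
Proof.
elim: s => [|i s IHs].
  by rewrite big_nil -diagmon1; apply: eq_diagmon => j; rewrite big_nil.
by rewrite big_cons IHs diagmonM; apply: eq_diagmon => j; rewrite big_cons.
Qed.

(** The position is a natural number, so that it can be shifted when blocks are
put together; this makes [dmon k r] convertible to [delta _ 0 r]. *)
Definition delta n (j : nat) x : mon gT n :=
  diagmon (fun i => if i == j :> nat then x else 1).

Lemma deltaM n j : {morph @delta n j : x y / x * y}.
Proof.
move=> x y; rewrite diagmonM; apply: eq_diagmon => i.
by case: eqP => // _; rewrite mulg1.
Qed.

Lemma delta1 n j : delta n j 1 = 1.
Proof. by rewrite -diagmon1; apply: eq_diagmon => i; case: eqP. Qed.

Lemma deltaV n j x : delta n j x^-1 = (delta n j x)^-1.
Proof. by apply/eqP; rewrite eq_sym eq_invg_mul -deltaM mulgV delta1. Qed.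

Lemma diagmon_delta n (f : 'I_n -> gT) : diagmon f = \prod_(i < n) delta n i (f i).
Proof.
rewrite diagmon_prod; apply: eq_diagmon => j.
by rewrite -big_mkcond (big_pred1 j).
Qed.

Definition diag_set n (A : {set gT}) : {set mon gT n} :=
  [set diagmon f | f : {ffun 'I_n -> gT} in ffun_on A].

Lemma diag_setP n (A : {set gT}) (X : mon gT n) :
  reflect (exists2 f : 'I_n -> gT, forall i, f i \in A & X = diagmon f)
          (X \in diag_set n A).
Proof.
apply: (iffP imsetP) => [[f /ffun_onP Af ->] | [f Af ->]]; first by exists f.
exists (finfun f); first by apply/ffun_onP=> i; rewrite ffunE.
by apply: eq_diagmon => i; rewrite ffunE.
Qed.

Lemma diag_group_set n A : group_set (diag_set n A).
Proof.
apply/group_setP; split=> [|_ _ /diag_setP[f Af ->] /diag_setP[g Ag ->]].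
  by apply/diag_setP; exists (fun=> 1).
apply/diag_setP; rewrite diagmonM.
by exists (fun i => f i * g i) => // i; rewrite groupM.
Qed.

Canonical diag_group n A := Group (diag_group_set n A).

Lemma card_diag_set n (A : {set gT}) : #|diag_set n A| = (#|A| ^ n)%N.
Proof.
rewrite card_in_imset ?card_ffun_on ?card_ord // => f g _ _ fg.
exact/ffunP/diagmon_inj.
Qed.

Lemma diag_abelem p n A : prime p -> p.-abelem A -> p.-abelem (diag_set n A).
Proof.
move=> p_pr /(abelemP p_pr)[cAA expA]; apply/(abelemP p_pr); split.
  apply/centsP=> _ /diag_setP[f Af ->] _ /diag_setP[g Ag ->].
  rewrite /commute !diagmonM; apply: eq_diagmon => i.
  exact: (centsP cAA).
move=> _ /diag_setP[f Af ->].
have -> : diagmon f ^+ p = diagmon (fun i => f i ^+ p).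
  elim: p {p_pr expA} => [|p IHp]; first by rewrite expg0.
  by rewrite expgS IHp diagmonM; apply: eq_diagmon => i; rewrite expgS.
by rewrite -diagmon1; apply: eq_diagmon => i; apply: expA.
Qed.

Lemma delta_diag n j x A : x \in A -> delta n j x \in diag_set n A.
Proof.
move=> Ax; apply/diag_setP.
by exists (fun i : 'I_n => if i == j :> nat then x else 1) => // i; case: ifP.
Qed.

(** * Block diagonal matrices *)

Lemma bdiagM k l (X X' : mon gT k) (Y Y' : mon gT l) :
  bdiag X Y * bdiag X' Y' = bdiag (X * X') (Y * Y').
Proof.
have mul00 (x : option gT) : mul0 x None = None by case: x.
have add0N (x : option gT) : add0 x None = x by case: x.
pose blockE := (block_mxEul, block_mxEur, block_mxEdl, block_mxEdr).
apply: val_inj; apply/matrixP => i j; rewrite /= mxE big_split_ord /=.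
case: (split_ordP i) => {}i ->; case: (split_ordP j) => {}j ->.
- rewrite block_mxEul mxE [X in add0 _ X]big1 ?add0N => [|h _].
    by apply: eq_bigr => h _; rewrite !blockE.
  by rewrite !blockE mxE.
- by rewrite block_mxEur mxE !big1 // => h _; rewrite !blockE mxE ?mul00.
- by rewrite block_mxEdl mxE !big1 // => h _; rewrite !blockE mxE ?mul00.
rewrite block_mxEdr mxE big1 => [|h _]; last by rewrite !blockE mxE.
by apply: eq_bigr => h _; rewrite !blockE.
Qed.

Lemma bdiag_diagmon k l (f : 'I_(k + l) -> gT) :
  bdiag (diagmon (f \o @lshift k l)) (diagmon (f \o @rshift k l)) = diagmon f.
Proof.
apply: val_inj; apply/matrixP => i j; rewrite /= [RHS]mxE perm1.
case: (split_ordP i) => {}i ->; case: (split_ordP j) => {}j ->.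
- by rewrite block_mxEul mxE perm1 (inj_eq (@lshift_inj _ _)).
- by rewrite block_mxEur mxE eq_rlshift.
- by rewrite block_mxEdl mxE eq_lrshift.
by rewrite block_mxEdr mxE perm1 (inj_eq (@rshift_inj _ _)).
Qed.

Lemma bdiag11 k l : bdiag 1 1 = 1 :> mon gT (k + l).
Proof. exact: (bdiag_diagmon (fun=> 1)). Qed.

Lemma bdiag_delta_l k l j x :
  (j < k)%N -> bdiag (delta k j x) 1 = delta (k + l) j x.
Proof.
move=> ltjk; rewrite -[RHS]bdiag_diagmon -diagmon1; congr (bdiag _ _).
apply: eq_diagmon => i /=; case: eqP => // Dj.
by rewrite -Dj ltnNge leq_addr in ltjk.
Qed.

Lemma bdiag_delta_r k l j x : bdiag 1 (delta l j x) = delta (k + l) (k + j) x.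
Proof.
rewrite -[RHS]bdiag_diagmon -diagmon1; congr (bdiag _ _).
  apply: eq_diagmon => i /=; case: eqP => // Di.
  by have := ltn_ord i; rewrite Di ltnNge leq_addr.
by apply: eq_diagmon => i /=; rewrite eqn_add2l.
Qed.

Lemma bdiagV k l (X : mon gT k) (Y : mon gT l) :
  (bdiag X Y)^-1 = bdiag X^-1 Y^-1.
Proof. by apply/eqP; rewrite eq_invg_mul bdiagM !mulgV bdiag11. Qed.

Lemma dim_gt0 k : (0 < dim k)%N.
Proof. by rewrite dimE expn_gt0. Qed.

(** * Diagonal matrices in one block *)

Lemma wmon1 T R k : 1 \in wmon T R k.
Proof.
case: k => [|k] /=; last exact: group1.
by apply/imsetP; exists 1; rewrite ?group1 //= -[RHS]/(delta _ 0 1) delta1.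
Qed.

Lemma wmon_bdiag_l T R k a : a \in wmon T R k -> bdiag a 1 \in wmon T R k.+1.
Proof.
move=> wa; apply: mem_gen; do 3!(apply/setUP; left).
by apply/imsetP; exists a.
Qed.

Lemma wmon_bdiag_r T R k a : a \in wmon T R k -> bdiag 1 a \in wmon T R k.+1.
Proof.
move=> wa; apply: mem_gen; do 2!(apply/setUP; left); apply/setUP; right.
by apply/imsetP; exists a.
Qed.

Lemma delta_wmon T R k j t :
  t \in T -> (j < dim k)%N -> delta (dim k) j t \in wmon T R k.
Proof.
move=> Tt; elim: k j => [|k IHk] j ltj.
  by case: j ltj => // _; apply: (imset_f _ Tt).
have [ltjk | lekj] := ltnP j (dim k).
  by rewrite -[delta _ _ _]bdiag_delta_l // wmon_bdiag_l ?IHk.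
rewrite -(subnKC lekj) -[delta _ _ _]bdiag_delta_r wmon_bdiag_r ?IHk //.
by rewrite ltn_subLR.
Qed.

(** A position in the second half is reached from position [0] by way of the
first position of that half, with the generator [diag(d_k(r), d_k(r)^-1)]. *)
Lemma delta_ratio_wmon T R k j r :
    r \in R -> (j < dim k)%N ->
  delta (dim k) j r * (delta (dim k) 0 r)^-1 \in wmon T R k.
Proof.
move=> Rr; elim: k j => [|k IHk] j ltj.
  by case: j ltj => // _; rewrite mulgV wmon1.
have D0: delta (dim k.+1) 0 r = bdiag (delta (dim k) 0 r) 1.
  by rewrite bdiag_delta_l ?dim_gt0.
have [ltjk | lekj] := ltnP j (dim k).
  rewrite D0 bdiagV invg1 -[delta _ j r]bdiag_delta_l // bdiagM mulg1.
  by rewrite wmon_bdiag_l ?IHk.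
rewrite -(subnKC lekj); set i := (j - _)%N.
have ltik: (i < dim k)%N by rewrite ltn_subLR.
have ->: delta (dim k.+1) (dim k + i) r * (delta _ 0 r)^-1 =
    bdiag 1 (delta (dim k) i r * (delta (dim k) 0 r)^-1)
      * (bdiag (dmon k r) (dmon k r)^-1)^-1.
  rewrite D0 !bdiagV -[delta _ (_ + _) _]bdiag_delta_r !bdiagM.
  rewrite invgK invg1 mulg1 !mul1g.
  by congr (bdiag _ _); rewrite mulgKV.
apply: groupM; first exact/wmon_bdiag_r/IHk.
rewrite groupV.
apply: mem_gen; apply/setUP; left; apply/setUP; right.
by apply/imsetP; exists r.
Qed.

(** * Diagonal matrices in the whole group *)

Lemma Wmon1 T R m : 1 \in Wmon T R m.
Proof.
elim: m => [|k m IHm] /=; first exact: set11.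
by apply/imsetP; exists (1, 1); rewrite ?bdiag11 // in_setX wmon1.
Qed.

Lemma Wmon_bdiag T R k m a b :
  a \in wmon T R k -> b \in Wmon T R m -> bdiag a b \in Wmon T R (k :: m).
Proof. by move=> wa Wb; apply/imsetP; exists (a, b); rewrite // in_setX wa. Qed.

Lemma Smon_bdiag_l T R k m a :
  a \in wmon T R k -> bdiag a 1 \in Smon T R (k :: m).
Proof.
move=> wa; apply: (subsetP (joing_subl _ _)).
by apply: Wmon_bdiag => //; apply: Wmon1.
Qed.

Lemma bdiag1_morphM k l : {in setT &, {morph @bdiag gT k l 1 : X Y / X * Y}}.
Proof. by move=> X Y _ _; rewrite bdiagM mulg1. Qed.

Lemma Smon_bdiag_r T R k m b :
  b \in Smon T R m -> bdiag 1 b \in Smon T R (k :: m).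
Proof.
pose f := Morphism (@bdiag1_morphM (dim k) (dims m)).
suffices /subsetP sSf: Smon T R m \subset f @*^-1 Smon T R (k :: m).
  by move/sSf; rewrite !inE.
rewrite join_subG gen_subG; apply/andP; split; apply/subsetP=> X.
  rewrite !inE => WX; apply: (subsetP (joing_subl _ _)).
  by apply: Wmon_bdiag; rewrite ?wmon1.
case/bigcupP=> i _ /imsetP[r Rr ->]; rewrite !inE.
apply: (subsetP (joing_subr _ _)); apply: mem_gen.
have lti: (i.+1 < (size (k :: m)).-1)%N by rewrite /= -ltn_predRL.
by apply/bigcupP; exists (Ordinal lti) => //; apply/imsetP; exists r.
Qed.

Lemma delta_Smon T R m j t :
  t \in T -> (j < dims m)%N -> delta (dims m) j t \in Smon T R m.
Proof.
move=> Tt; elim: m j => //= k m IHm j ltj.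
have [ltjk | lekj] := ltnP j (dim k).
  by rewrite -bdiag_delta_l // Smon_bdiag_l ?delta_wmon.
by rewrite -(subnKC lekj) -bdiag_delta_r Smon_bdiag_r ?IHm // ltn_subLR.
Qed.

Lemma dblocks_pred0 r (P : pred nat) m : P =1 pred0 -> dblocks r P m = 1.
Proof.
elim: m P => //= k m IHm P P0.
by rewrite P0 /= IHm ?bdiag11 // => j; apply: P0.
Qed.

(** This generator of [U(R)] is the link between the first block and the
remaining ones in the induction on the list of blocks. *)
Lemma bdiag_delta0_Smon T R k l m r :
  r \in R -> bdiag (delta (dim k) 0 r) (delta (dims (l :: m)) 0 r)
               \in Smon T R [:: k, l & m].
Proof.
move=> Rr; apply: (subsetP (joing_subr _ _)); apply: mem_gen.
apply/bigcupP; exists ord0 => //; apply/imsetP; exists r => //=.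
by rewrite dblocks_pred0 // [bdiag (dmon l r) 1]bdiag_delta_l ?dim_gt0.
Qed.

(** For [j] beyond the first block, let [p] be the first position of the second
block.  Induction on the list of blocks gives [delta j r * (delta p r)^-1], and
[delta 0 r * delta p r] is in [U(R)].  In their product the entries at [p]
cancel, and the entry [r] at position [0] is [r^-1] because [r = r^-1]. *)
Lemma delta_ratio_Smon T R m j r :
    r \in R -> r^-1 = r -> (j < dims m)%N ->
  delta (dims m) j r * (delta (dims m) 0 r)^-1 \in Smon T R m.
Proof.
move=> Rr rV; elim: m j => // k m IHm j ltj.
have D0: delta (dims (k :: m)) 0 r = bdiag (delta (dim k) 0 r) 1.
  by rewrite bdiag_delta_l ?dim_gt0.
have [ltjk | lekj] := ltnP j (dim k).
  rewrite D0 bdiagV invg1 -[delta _ j r]bdiag_delta_l // bdiagM mulg1.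
  by rewrite Smon_bdiag_l ?delta_ratio_wmon.
rewrite -(subnKC lekj); set i := (j - _)%N.
have ltim: (i < dims m)%N by rewrite ltn_subLR.
case: m => [|l m] // in IHm ltim D0 ltj *.
have ->: delta (dims [:: k, l & m]) (dim k + i) r * (delta _ 0 r)^-1 =
    bdiag 1 (delta (dims (l :: m)) i r * (delta (dims (l :: m)) 0 r)^-1)
      * bdiag (delta (dim k) 0 r) (delta (dims (l :: m)) 0 r).
  rewrite D0 bdiagV -[delta _ (_ + _) _]bdiag_delta_r !bdiagM invg1 mulg1.
  by rewrite mulgKV -deltaV rV.
by apply: groupM; [apply/Smon_bdiag_r/IHm | apply: bdiag_delta0_Smon].
Qed.

End Diagonal.

(** * The rank of the maximal elementary abelian subgroups *)

Theorem lemma4p5 (gT : finGroupType) (T R TR : {group gT}) (n : nat)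
    (m : seq nat) (E0 R0 : {group gT}) (E : {group mon gT (dims m)}) :
  2.-group T -> 2.-group R -> abelian R -> T ><| R = TR ->
  (0 < n)%N -> sorted ltn m -> n = (\sum_(k <- m) 2 ^ k)%N ->
  E0 \subset T -> 2.-abelem E0 ->
  R0 \subset R -> 2.-abelem R0 ->
  E0 <*> R0 = E0 \x R0 -> 2.-abelem (E0 <*> R0) ->
  E \in 'E_2^('r_2(Smon T R m))(Smon T R m) ->
  (n * 'r_2(E0) + n.-1 * 'r_2(R0) <= 'r_2(E))%N.
Proof.
move=> _ _ _ _ n_gt0 _; rewrite -dimsE => Dn sE0T abE0 sR0R abR0.
move=> /esym defA abA ES; subst n.
have [_ abE rankE] := pnElemP ES; rewrite (p_rank_abelem abE) rankE.
clear E abE rankE ES.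
set S := Smon T R m ; set n := dims m in n_gt0 *.
pose Delta := diag_group n (E0 <*> R0)%G; pose D := (Delta :&: S)%G.
have abDelta: 2.-abelem Delta by apply: diag_abelem.
have abD: 2.-abelem D by apply: abelemS abDelta; apply: subsetIl.
have delta_morphM: {in R0 &, {morph @delta gT n 0 : x y / x * y}}.
  by move=> x y _ _; apply: deltaM.
pose Z := (Morphism delta_morphM @* R0)%G.
have ZP r : r \in R0 -> delta n 0 r \in Z.
  by move=> R0r; apply: (@mem_morphim _ _ _ (Morphism delta_morphM)).
have sZDelta: Z \subset Delta.
  apply/subsetP=> _ /morphimP[r _ R0r ->]; apply: delta_diag.
  exact: (subsetP (joing_subr _ _)).
have cDZ: commute D Z.
  apply/normC/cents_norm; apply: centSS (abelem_abelian abDelta) => //.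
  exact: subsetIl.
have sDeltaDZ: Delta \subset D <*> Z.
  apply/subsetP=> _ /diag_setP[f Af ->]; rewrite diagmon_delta.
  apply: group_prod => i _; have := Af i; rewrite -(dprodW defA).
  case/mulsgP=> a r E0a R0r ->.
  have AE0 : a \in E0 <*> R0 by apply: (subsetP (joing_subl _ _)).
  have AR0 : r \in E0 <*> R0 by apply: (subsetP (joing_subr _ _)).
  have rV: r^-1 = r.
    apply/eqP; rewrite eq_invg_mul -expg2.
    by have [_ ->] := abelemP (isT : prime 2) abR0.
  have -> : delta n i (a * r) =
      delta n i a * (delta n i r * (delta n 0 r)^-1) * delta n 0 r.
    by rewrite deltaM -!mulgA mulVg mulg1.
  rewrite groupM ?[delta n 0 r \in _](subsetP (joing_subr _ _)) ?ZP //.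
  apply: (subsetP (joing_subl _ _)); rewrite groupM // inE; apply/andP; split.
  - exact: delta_diag.
  - by rewrite delta_Smon // (subsetP sE0T).
  - by rewrite groupM ?groupV //; apply: delta_diag.
  by rewrite delta_ratio_Smon // (subsetP sR0R).
have leDelta: (logn 2 #|Delta| <= logn 2 #|D| + 'r_2(R0))%N.
  rewrite (p_rank_abelem abR0) -lognM ?cardG_gt0 //.
  apply: dvdn_leq_log; rewrite ?muln_gt0 ?cardG_gt0 //.
  have dvDZ: #|D <*> Z| %| #|D| * #|Z|.
    by rewrite mul_cardG -(comm_joingE cDZ) dvdn_mulr.
  apply: dvdn_trans (cardSg sDeltaDZ) (dvdn_trans dvDZ _).
  by rewrite dvdn_pmul2l ?cardG_gt0 ?dvdn_morphim.
have leD: (logn 2 #|D| <= 'r_2(S))%N.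
  by apply: logn_le_p_rank; apply/pElemP; rewrite subsetIr.
(* The truncated subtraction in [n.-1] disappears once ['r_2(R0)] is added. *)
apply: leq_trans leD; rewrite -(leq_add2r 'r_2(R0)).
apply: leq_trans leDelta.
rewrite card_diag_set lognX -(dprod_card defA) lognM ?cardG_gt0 //.
by rewrite -!(p_rank_abelem _) // mulnDr -addnA -mulSnr prednK.
Qed.
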